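(* Let $n$ be a positive integer and let $G$ be the free abelian group on the symbols $(A,s)$ with $A\subseteq[n]$ and $s\in\mathbb{Z}_{\geq 0}$. The function $F:\mathsf{Mat}_n\to G$ defined by $$F(M)=\sum_{A\subseteq[n]} (A, r_M(A))$$ for every matroid $M\in\mathsf{Mat}_n$ with at least one basis, and $F(\emptyset)=0$ for the matroid $\emptyset=([n],\emptyset)$ with no bases, is a valuation under matroid subdivision.
   Context: Write $[n]=\{1,\dots,n\}$. A matroid is a pair $M=(E,\mathcal{B})$ where $E$ is a finite set and $\mathcal{B}$ is a collection of subsets of $E$ (the bases) satisfying the basis exchange axiom: if $B_1,B_2\in\mathcal{B}$ and $b_1\in B_1-B_2$, there is $b_2\in B_2-B_1$ with $(B_1-b_1)\cup b_2\in\mathcal{B}$. Contrary to custom, $(E,\emptyset)$ (no bases) is allowed as a matroid. $\mathsf{Mat}_n$ denotes the set of matroids with ground set $[n]$; the matroid $([n],\emptyset)$ is denoted $\emptyset$, and by convention every function $f$ on $\mathsf{Mat}_n$ that is considered satisfies $f(\emptyset)=0$. A subset of $E$ is independent if it is contained in a basis; the rank $r_M(A)$ of $A\subseteq E$ is the common size of the maximal independent subsets of $A$. The matroid polytope of $M=([n],\mathcal{B})$ is $Q(M)=\mathrm{conv}\{e_B : B\in\mathcal{B}\}\subset\mathbb{R}^n$, where $e_B=\sum_{b\in B}e_b$ and $e_1,\dots,e_n$ is the standard basis. $M$ is determined by $Q(M)$, and any nonempty face of a matroid polytope is a matroid polytope. A subdivision of a polytope $P$ is a set of polytopes $\{P_1,\dots,P_m\}$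 whose vertices are vertices of $P$, such that $P_1\cup\cdots\cup P_m=P$ and, for all $i<j$, if $P_i\cap P_j$ is nonempty then it is a proper face of both $P_i$ and $P_j$. A matroid subdivision of $M$ into $M_1,\dots,M_m$ is a subdivision of $Q(M)$ into the matroid polytopes $Q(M_1),\dots,Q(M_m)$. For $A\subseteq[m]$, $M_A$ is the matroid whose polytope is $\bigcap_{a\in A}Q(M_a)$ (so $M_A=\emptyset$ if this intersection is empty), with $M_\emptyset=M$ for the empty index set. For an abelian group $G$, a function $f:\mathsf{Mat}_n\to G$ is a valuation under matroid subdivision if for every matroid subdivision $\{M_1,\dots,M_m\}$ of every $M\in\mathsf{Mat}_n$, $\sum_{A\subseteq[m]}(-1)^{|A|}f(M_A)=0$; equivalently $f(M)=\sum_i f(M_i)-\sum_{i<j}f(M_{ij})+\sum_{i<j<k}f(M_{ijk})-\cdots$. *)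

(* Defs.v *)
From HB Require Import structures.
From mathcomp Require Import all_boot all_order all_algebra.
From mathcomp Require Import freeg.
From mathcomp Require Import all_classical all_reals convex.

Set Implicit Arguments.
Unset Strict Implicit.
Unset Printing Implicit Defensive.

Import Order.TTheory GRing.Theory Num.Theory.

Local Open Scope classical_set_scope.
Local Open Scope ring_scope.

(* The ground set {1, ..., n} is encoded as 'I_n. Nonemptiness of the collection
   of bases is deliberately not required. *)
Definition basis_exchange (n : nat) (BB : {set {set 'I_n}}) : bool :=
  [forall B1 in BB, forall B2 in BB, forall b1 in B1 :\: B2,
     exists b2 in B2 :\: B1, b2 |: (B1 :\ b1) \in BB].

Record matroid (n : nat) := Matroid {
  bases : {set {set 'I_n}};
  _ : basis_exchange bases
}.

HB.instance Definition _ (n : nat) := [isSub for @bases n].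
HB.instance Definition _ (n : nat) := [Choice of matroid n by <:].

Lemma basis_exchange0 (n : nat) : @basis_exchange n finset.set0.
Proof. by apply/forall_inP => B1; rewrite finset.in_set0. Qed.

Definition empty_matroid (n : nat) : matroid n := Matroid (basis_exchange0 n).

Definition independent (n : nat) (M : matroid n) (I : {set 'I_n}) : bool :=
  [exists B in bases M, I \subset B].

(* All the inclusion-maximal independent subsets of A have the same size, so
   this maximum is taken over equal values. *)
Definition rank (n : nat) (M : matroid n) (A : {set 'I_n}) : nat :=
  \max_(I : {set 'I_n} |
        finset.maxset [pred J : {set 'I_n} | independent M J & J \subset A] I)
     #|I|.

Definition convex_hull (R : realType) (n : nat) (X : set 'rV[R]_n) :
    set 'rV[R]_n :=
  smallest (@convex_set R 'rV[R]_n) X.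

Definition polytope (R : realType) (n : nat) (P : set 'rV[R]_n) : Prop :=
  exists s : seq 'rV[R]_n, P = convex_hull [set` s].

Definition dot (R : realType) (n : nat) (w x : 'rV[R]_n) : R :=
  \sum_i w 0 i * x 0 i.

(* P itself (w = 0, c = 0) and the empty set (w = 0, c = 1) are faces of P. *)
Definition face (R : realType) (n : nat) (F P : set 'rV[R]_n) : Prop :=
  exists (w : 'rV[R]_n) (c : R),
    P `<=` [set x | dot w x <= c] /\ F = P `&` [set x | dot w x = c].

Definition proper_face (R : realType) (n : nat) (F P : set 'rV[R]_n) : Prop :=
  face F P /\ F <> P.

Definition vertex (R : realType) (n : nat) (v : 'rV[R]_n) (P : set 'rV[R]_n) :
    Prop :=
  face [set v] P.

(* The set {P_1, ..., P_m} is given by an indexed family. The last clause forces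
   the nonempty members to be distinct; the empty polytope may be repeated,
   which is harmless for functions vanishing on the matroid without bases. *)
Definition subdivision (R : realType) (n : nat) (P : set 'rV[R]_n)
    (m : nat) (Ps : 'I_m -> set 'rV[R]_n) : Prop :=
  [/\ forall i : 'I_m, polytope (Ps i),
      forall (i : 'I_m) (v : 'rV[R]_n), vertex v (Ps i) -> vertex v P,
      \bigcup_i Ps i = P &
      forall i j : 'I_m, (i < j)%N -> Ps i `&` Ps j !=set0 ->
        proper_face (Ps i `&` Ps j) (Ps i) /\
        proper_face (Ps i `&` Ps j) (Ps j)].

Definition indicator_vector (R : realType) (n : nat) (B : {set 'I_n}) :
    'rV[R]_n :=
  \sum_(b in B) delta_mx 0 b.

Definition matroid_polytope (R : realType) (n : nat) (M : matroid n) :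
    set 'rV[R]_n :=
  convex_hull [set indicator_vector R B | B in [set` bases M]].
Arguments matroid_polytope R {n} M _.

Definition matroid_subdivision (R : realType) (n : nat) (M : matroid n)
    (m : nat) (Ms : 'I_m -> matroid n) : Prop :=
  subdivision (matroid_polytope R M) (fun i => matroid_polytope R (Ms i)).

(* [xget] picks the matroid with the given polytope. It is unique, and for a
   matroid subdivision it exists; the default value plays no role there. *)
Definition cell_matroid (R : realType) (n : nat) (M : matroid n)
    (m : nat) (Ms : 'I_m -> matroid n) (A : {set 'I_m}) : matroid n :=
  if A == finset.set0 then M
  else xget (empty_matroid n)
         [set N | matroid_polytope R N =
                  \bigcap_(a in [set` A]) matroid_polytope R (Ms a)].

Definition is_valuation (R : realType) (n : nat) (G : zmodType)
    (f : matroid n -> G) : Prop :=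
  f (empty_matroid n) = 0 /\
  forall (M : matroid n) (m : nat) (Ms : 'I_m -> matroid n),
    matroid_subdivision R M Ms ->
    \sum_(A : {set 'I_m}) f (cell_matroid R M Ms A) *~ (-1) ^+ #|A| = 0.

Definition rank_sum (n : nat) (M : matroid n) :
    {freeg ({set 'I_n} * nat)} :=
  if bases M == finset.set0 then 0
  else \sum_(A : {set 'I_n}) << (A, rank M A) >>.

(* Main.v *)
Require Import Defs.
From mathcomp Require Import all_boot all_order all_algebra.
From mathcomp Require Import freeg.
From mathcomp Require Import all_classical all_reals.
From mathcomp Require Import interval_inference topology normedtype derive convex.
From mathcomp Require Import ring lra.

(** The coefficient of (A, s) in F(M) is 1 when M has a basis and r_M(A) = s,
    and 0 otherwise.  Since r_M(A) is the maximum of the linear form e_A over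
    Q(M), the condition r_M(A) >= s says that Q(M) meets the closed halfspace
    H_s = {x | e_A . x >= s}, so this coefficient is
    [Q(M) meets H_s] - [Q(M) meets H_(s+1)] ([coeff_rank_sum]).  It remains to
    see that M |-> [Q(M) meets H] is a valuation for a closed halfspace H.

    This is the existence of the Euler characteristic on compact convex sets
    ([compact_convex_euler]): an integer relation between the indicator
    functions of finitely many compact convex sets persists when each indicator
    function is replaced by 1 or 0 according to whether the set is nonempty.
    In a subdivision the cells cover Q(M), so by inclusion-exclusion
    sum_J (-1)^|J| [x in Q(M_J)] = 0 at every point x; intersecting with H and
    applying the Euler relation to the sets Q(M_J) /\ H gives the result.

    The Euler relation is proved one coordinate at a time.  On each hyperplane
    x_k = t the relation holds by induction, which says that the indicator
    functions of the projections to the k-th axis, which are compact intervals,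
    satisfy the same relation; for intervals one counts right endpoints
    ([interval_euler]).  Compactness of the polytopes is used here: the
    projections must be closed.

    Finally M_J has to be a matroid with polytope the intersection of the
    cells ([cell_polytope]).  That intersection is a face of any one of the
    cells, and a face of a matroid polytope is a matroid polytope because the
    bases of maximal weight satisfy the exchange axiom
    ([basis_exchange_max]), a consequence of the symmetric exchange property
    ([symmetric_exchange]). *)

Set Implicit Arguments.
Unset Strict Implicit.
Unset Printing Implicit Defensive.

Import Order.TTheory GRing.Theory Num.Theory numFieldNormedType.Exports.

(** * Basis exchange *)

Lemma basis_exchangeP n (BB : {set {set 'I_n}}) :
  reflect (forall B1 B2 b1, B1 \in BB -> B2 \in BB -> b1 \in B1 -> b1 \notin B2 ->
             exists b2, [/\ b2 \in B2, b2 \notin B1 & b2 |: (B1 :\ b1) \in BB])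
          (basis_exchange BB).
Proof.
apply: (iffP idP) => [ex B1 B2 b1 B1in B2in b1B1 b1B2 | ex].
  have b1D : b1 \in B1 :\: B2 by rewrite finset.in_setD b1B1 b1B2.
  move/forall_inP/(_ _ B1in)/forall_inP/(_ _ B2in)/forall_inP/(_ _ b1D): ex.
  by case/exists_inP => b2; rewrite finset.in_setD => /andP[? ?] ?; exists b2.
apply/forall_inP => B1 B1in; apply/forall_inP => B2 B2in.
apply/forall_inP => b1; rewrite finset.in_setD => /andP[b1B2 b1B1].
have [b2 [b2B2 b2B1 new]] := ex _ _ _ B1in B2in b1B1 b1B2.
by apply/exists_inP; exists b2; rewrite ?finset.in_setD ?b2B2 ?b2B1.
Qed.

(** Among the bases containing I, one with fewest elements outside I :|: B
    has none: such an element could be exchanged for an element of B. *)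
Lemma basis_augment n (BB : {set {set 'I_n}}) (I B0 B : {set 'I_n}) :
  basis_exchange BB -> B0 \in BB -> I \subset B0 -> B \in BB ->
  exists2 C, C \in BB & (I \subset C) && (C \subset I :|: B).
Proof.
move/basis_exchangeP => ex B0in IB0 Bin.
have [k] := ubnP #|B0 :\: (I :|: B)|.
elim: k B0 B0in IB0 => // k IHk B0 B0in IB0; rewrite ltnS => le_k.
have [sub | nsub] := boolP (B0 \subset I :|: B); first by exists B0; rewrite ?IB0.
case/subsetPn: nsub => b bB0; rewrite finset.in_setU negb_or => /andP[bI bB].
have [c [cB cB0 newin]] := ex _ _ _ B0in Bin bB0 bB.
apply: IHk newin _ _.
  apply/fintype.subsetP => x xI; rewrite !finset.inE (fintype.subsetP IB0 _ xI) andbT.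
  have [xb|] := eqVneq x b; last by rewrite orbT.
  by rewrite -xb xI in bI.
apply: leq_trans le_k; apply: proper_card; apply/properP; split.
  apply/fintype.subsetP => x; rewrite !finset.inE negb_or => /andP[/andP[-> xB]].
  have [xc|_] := eqVneq x c; first by rewrite xc cB in xB.
  by rewrite xB /= => /andP[].
exists b; first by rewrite !finset.inE negb_or bI bB bB0.
rewrite !finset.inE eqxx /= orbF negb_and negbK.
have [bc|_] := eqVneq b c; first by rewrite bc cB in bB.
by rewrite orbT.
Qed.

(** The set D of the elements of B2 that b1 can replace is the fundamental
    circuit of b1 in B2 without b1.  A basis B3 between D and D :|: B1 cannot
    contain b1, because the circuit b1 |: D is dependent, so exchanging b1 for
    an element of B3 yields an element of D. *)
Lemma symmetric_exchange n (BB : {set {set 'I_n}}) (B1 B2 : {set 'I_n}) b1 :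
  basis_exchange BB -> B1 \in BB -> B2 \in BB -> b1 \in B1 -> b1 \notin B2 ->
  exists b2, [/\ b2 \in B2, b2 \notin B1, b2 |: (B1 :\ b1) \in BB
                & b1 |: (B2 :\ b2) \in BB].
Proof.
move=> exB B1in B2in b1B1 b1B2; have /basis_exchangeP ex := exB.
pose D := finset (fun b => (b \in B2) && (b1 |: (B2 :\ b) \in BB)).
have DB2 : D \subset B2 by apply/fintype.subsetP => b; rewrite finset.inE => /andP[].
have [B3 B3in /andP[DB3 B3D]] := basis_augment exB B2in DB2 B1in.
have b1B3 : b1 \notin B3.
  apply/negP => b1B3.
  (* Otherwise b1 |: D extends to a basis C inside b1 |: B2; exchanging an
     element b of B2 :\: C against b1 shows b \in D, although D \subset C. *)
  have D1B3 : b1 |: D \subset B3 by rewrite finset.subUset finset.sub1set b1B3.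
  have [C Cin /andP[D1C CD]] := basis_augment exB B3in D1B3 B2in.
  have CsubB2 : C \subset b1 |: B2.
    apply: fintype.subset_trans CD _; rewrite -finset.setUA finset.setUS//.
    by rewrite finset.subUset DB2 fintype.subxx.
  have b1C : b1 \in C by apply: (fintype.subsetP D1C); rewrite !finset.inE eqxx.
  have [B2C | ] := boolP (B2 \subset C).
    have [c [cB2 /negP[]]] := ex _ _ _ Cin B2in b1C b1B2.
    by rewrite (fintype.subsetP B2C).
  case/subsetPn => b bB2 bC.
  have [c [cC cB2 newin]] := ex _ _ _ B2in Cin bB2 bC.
  have cb1 : c = b1.
    move/fintype.subsetP: CsubB2 => /(_ _ cC).
    by rewrite !finset.inE (negPf cB2) orbF => /eqP.
  case/negP: bC; apply: (fintype.subsetP D1C); rewrite !finset.inE bB2 -cb1 newin.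
  by rewrite orbT.
have [b2 [b2B3 b2B1 new1]] := ex _ _ _ B1in B3in b1B1 b1B3.
have : b2 \in D.
  by move/fintype.subsetP: B3D => /(_ _ b2B3); rewrite finset.in_setU (negPf b2B1) orbF.
by rewrite finset.inE => /andP[b2B2 new2]; exists b2.
Qed.

(** * The Euler relation for compact intervals *)

Local Open Scope classical_set_scope.
Local Open Scope ring_scope.

(** The point t' is t plus an infinitesimal, as far as the numbers in s can
    tell. *)
Lemma right_gap (R : realFieldType) (s : seq R) (t : R) :
  exists2 t', t < t' & {in s, forall u, t < u -> t' < u}.
Proof.
elim: s => [|v s [t1 t1gt t1s]]; first by exists (t + 1); rewrite ?ltrDl.
have [tv | vt] := ltP t v; last first.
  exists t1 => // u; rewrite in_cons => /predU1P[-> tv|]; last exact: t1s.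
  by rewrite ltNge vt in tv.
exists (Num.min t1 ((t + v) / 2)); first by rewrite lt_min t1gt midf_lt.
move=> u; rewrite in_cons gt_min => /predU1P[-> _|us tu].
  by rewrite (midf_lt tv) orbT.
by rewrite t1s.
Qed.

(** The indicator function of [l, r] drops just after t exactly when r = t, so
    for each t the weights of the intervals with right endpoint t sum to 0;
    adding over all right endpoints gives the claim. *)
Lemma interval_euler (R : realFieldType) (I : finType) (D : pred I)
    (a : I -> int) (l r : I -> R) :
  (forall i, D i -> l i <= r i) ->
  (forall t, \sum_(i | D i) a i * (l i <= t <= r i)%R%:R = 0) ->
  \sum_(i | D i) a i = 0.
Proof.
move=> lr sum0.
have end0 t : \sum_(i | D i) a i * (r i == t)%:R = 0.
  have [t' tt' gap] := right_gap (codom l ++ codom r) t.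
  transitivity (\sum_(i | D i) a i * (l i <= t <= r i)%R%:R -
                \sum_(i | D i) a i * (l i <= t' <= r i)%R%:R);
    last by rewrite !sum0 subrr.
  rewrite -sumrB; apply: eq_bigr => i Di; rewrite -mulrBr; congr (_ * _).
  have gl : t < l i -> t' < l i by apply: gap; rewrite mem_cat codom_f.
  have gr : t < r i -> t' < r i by apply: gap; rewrite mem_cat codom_f orbT.
  have [tl|lt] := ltP t (l i).
    rewrite (leNgt _ t') gl//= subr0.
    by rewrite (gt_eqF (lt_le_trans tl (lr _ Di))).
  rewrite (le_trans lt (ltW tt'))/=.
  have [rt|tr|->] := ltgtP (r i) t.
  - by rewrite leNgt (lt_trans rt tt') subrr.
  - by rewrite (ltW (gr tr)) subrr.
  - by rewrite leNgt tt' subr0.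
pose s := undup (codom r).
transitivity (\sum_(i | D i) \sum_(t <- s) a i * (r i == t)%:R).
  apply: eq_bigr => i Di; rewrite -mulr_sumr.
  rewrite (bigD1_seq (r i)) ?undup_uniq ?mem_undup ?codom_f//= eqxx.
  by rewrite big1 ?addr0 ?mulr1// => t /negPf; rewrite eq_sym => ->.
by rewrite exchange_big big1.
Qed.

(** * The Euler relation for compact convex sets *)

Lemma convex_setP (R : realType) (n : nat) (C : set 'rV[R]_n) :
  @convex_set R 'rV[R]_n C <->
  (forall x y (t : R), C x -> C y -> 0 <= t -> t <= 1 ->
     C (t *: x + (1 - t) *: y)).
Proof.
split=> [cC x y t Cx Cy t0 t1 | cC x y t].
  have := cC x y (@Itv01 _ t t0 t1) (mem_set Cx) (mem_set Cy).
  by move=> /set_mem.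
move=> /set_mem Cx /set_mem Cy; apply/mem_set.
by apply: (cC x y t%:num).
Qed.

Lemma convexI (R : realType) (n : nat) (C D : set 'rV[R]_n) :
  @convex_set R 'rV[R]_n C -> @convex_set R 'rV[R]_n D ->
  @convex_set R 'rV[R]_n (C `&` D).
Proof.
rewrite !convex_setP => cC cD x y t [Cx Dx] [Cy Dy] t0 t1.
by split; [exact: cC | exact: cD].
Qed.

Lemma convex_coord_slice (R : realType) (n : nat) (j : 'I_n) (t : R) :
  @convex_set R 'rV[R]_n [set x : 'rV[R]_n | x 0 j = t].
Proof. by apply/convex_setP => x y s /= xt yt _ _; rewrite !mxE xt yt; lra. Qed.

Lemma closed_coord_slice (R : realType) (n : nat) (j : 'I_n) (t : R) :
  closed [set x : 'rV[R]_n | x 0 j = t].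
Proof.
have /continuous_closedP coordC := @coord_continuous R 1 n 0 j.
by apply: (coordC [set y | y = t]); exact: closed_eq.
Qed.

(** The extreme values of the coordinate are attained by compactness, and the
    values between them on the segment joining the two extreme points. *)
Lemma coord_range (R : realType) (n : nat) (C : set 'rV[R]_n) (j : 'I_n) :
  @convex_set R 'rV[R]_n C -> compact C -> C !=set0 ->
  exists lr : R * R, lr.1 <= lr.2 /\
    forall t, (C `&` [set x : 'rV[R]_n | x 0 j = t] !=set0) <-> lr.1 <= t <= lr.2.
Proof.
move=> /convex_setP cvC cC C0.
have cont : {within C, continuous (fun x : 'rV[R]_n => x 0 j)}.
  by apply: continuous_subspaceT; exact: coord_continuous.
have [x /set_mem Cx xmax] := EVT_max_rV C0 cC cont.
have [y /set_mem Cy ymin] := EVT_min_rV C0 cC cont.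
exists (y 0 j, x 0 j); split; first by apply: ymin; exact: mem_set.
move=> t; split => [[z [/mem_set Cz <-]] | /= /andP[yt tx]].
  by rewrite ymin// xmax.
have [xy|xy] := eqVneq (x 0 j) (y 0 j).
  by exists x; split => //=; apply/eqP; rewrite eq_le {1}xy yt tx.
have lt : 0 < x 0 j - y 0 j by rewrite subr_gt0 lt_neqAle eq_sym xy (le_trans yt tx).
set s := (t - y 0 j) / (x 0 j - y 0 j).
exists (s *: x + (1 - s) *: y); split => /=.
  apply: cvC => //; first by rewrite divr_ge0 ?(ltW lt)// subr_ge0.
  by rewrite ler_pdivrMr// mul1r lerB.
rewrite !mxE mulrBl mul1r addrCA -mulrBr /s divfK ?gt_eqF//; lra.
Qed.

(** Induction on the number k of coordinates that are not yet fixed to those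
    of c.  The inductive hypothesis applies to the slices of the C i at height t
    of the k-th coordinate, and turns the relation into one between the
    projections of the C i to that coordinate. *)
Lemma flat_euler (R : realType) (n k : nat) (I : finType) (a : I -> int)
    (C : I -> set 'rV[R]_n) (c : 'rV[R]_n) :
  (forall i, @convex_set R 'rV[R]_n (C i)) -> (forall i, compact (C i)) ->
  (forall i x, C i x -> forall j : 'I_n, (k <= j)%N -> x 0 j = c 0 j) ->
  (forall x, \sum_i a i * `[< C i x >]%:R = 0) ->
  \sum_i a i * `[< C i !=set0 >]%:R = 0.
Proof.
elim: k C c => [|k IHk] C c cvC cC flat sum0.
  rewrite -[RHS](sum0 c); apply: eq_bigr => i _; congr (_ * (nat_of_bool _)%:R).
  apply/asboolP/asboolP => [[x Cx]|Cc]; last by exists c.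
  (* With no free coordinate, C i is empty or the single point c. *)
  suff -> : c = x by [].
  by apply/rowP => j; rewrite (flat i x Cx).
have [kn|nk] := ltnP k n; last first.
  apply: (IHk C c) => // i x Cx j kj; apply: (flat _ _ Cx).
  by have := leq_ltn_trans kj (ltn_ord j); rewrite ltnNge nk.
pose j0 := Ordinal kn.
have slice t : \sum_i a i * `[< C i `&` [set x | x 0 j0 = t] !=set0 >]%:R = 0.
  pose c' : 'rV[R]_n := \row_j if j == j0 then t else c 0 j.
  apply: (IHk _ c') => [i|i|i x [Cx /= xt] j|x].
  - by apply: convexI => //; exact: convex_coord_slice.
  - by apply: compact_closedI => //; exact: closed_coord_slice.
  - rewrite mxE; case: eqVneq => [-> //|jj0]; rewrite leq_eqVlt => /predU1P[kj|kj].
      by case/eqP: jj0; apply: val_inj.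
    exact: flat Cx _ kj.
  have [xt|xt] := eqVneq (x 0 j0) t.
    rewrite -[RHS](sum0 x); apply: eq_bigr => i _; congr (_ * (nat_of_bool _)%:R).
    by apply/asboolP/asboolP => [[]|] //.
  apply: big1 => i _; case: asboolP => [[_ /= /eqP]|_]; last by rewrite mulr0.
  by rewrite (negPf xt).
pose D i := `[< C i !=set0 >].
have /choice[lr lrP] : forall i, exists lr : R * R, D i -> lr.1 <= lr.2 /\
    forall t, (C i `&` [set x : 'rV[R]_n | x 0 j0 = t] !=set0) <-> lr.1 <= t <= lr.2.
  move=> i; have [/asboolP Di|_] := boolP (D i); last by exists (0, 0).
  by have [lr lrP] := coord_range j0 (cvC i) (cC i) Di; exists lr.
have := @interval_euler R I D a (fun i => (lr i).1) (fun i => (lr i).2).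
rewrite big_mkcond => intE.
rewrite -[RHS]intE => [|i /lrP[]//|t].
  by apply: eq_bigr => i _; rewrite /D; case: asboolP; rewrite ?mulr1 ?mulr0.
rewrite -[RHS](slice t) big_mkcond; apply: eq_bigr => i _.
have [/lrP[_ tP]|/asboolPn Di] := boolP (D i).
  congr (_ * (nat_of_bool _)%:R); apply/idP/asboolP.
    exact: (proj2 (tP t)).
  exact: (proj1 (tP t)).
rewrite asboolF ?mulr0// => -[x [Cx _]].
by apply: Di; exists x.
Qed.

(** The Euler characteristic, which takes the value 1 on nonempty compact convex
    sets, extends linearly to the group spanned by their indicator functions. *)
Theorem compact_convex_euler (R : realType) (n : nat) (I : finType) (a : I -> int)
    (C : I -> set 'rV[R]_n) :
  (forall i, @convex_set R 'rV[R]_n (C i)) -> (forall i, compact (C i)) ->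
  (forall x, \sum_i a i * `[< C i x >]%:R = 0) ->
  \sum_i a i * `[< C i !=set0 >]%:R = 0.
Proof.
move=> cvC cC; apply: (@flat_euler R n n I a C 0) => // i x _ j.
by rewrite leqNgt ltn_ord.
Qed.

(** * Convex hulls of finite sets are compact *)

Lemma convex_hull_sub (R : realType) n (X : set 'rV[R]_n) : X `<=` convex_hull X.
Proof. exact: sub_gen_smallest. Qed.

Lemma convex_hull_min (R : realType) n (X C : set 'rV[R]_n) :
  @convex_set R 'rV[R]_n C -> X `<=` C -> convex_hull X `<=` C.
Proof. exact: smallest_sub. Qed.

Lemma convex_hull_convex (R : realType) n (X : set 'rV[R]_n) :
  @convex_set R 'rV[R]_n (convex_hull X).
Proof.
apply/convex_setP => x y t hx hy t0 t1 C [cvC XC].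
by move/convex_setP: (cvC); apply => //; [exact: hx | exact: hy].
Qed.

Lemma convex_hull0 (R : realType) n : convex_hull (@set0 'rV[R]_n) = set0.
Proof. by rewrite -subset0; apply: convex_hull_min. Qed.

(** The union of the segments from the apex v to C, hence the convex hull of v
    and C when C is convex and nonempty. *)
Definition cone_over (R : realType) n (v : 'rV[R]_n) (C : set 'rV[R]_n) :=
  [set t *: v + (1 - t) *: y | t in `[0, 1] & y in C].

(** A point between two segments from v lies on the segment from v to a
    weighted mean of their endpoints. *)
Lemma cone_over_convex (R : realType) n (v : 'rV[R]_n) (C : set 'rV[R]_n) :
  @convex_set R 'rV[R]_n C -> @convex_set R 'rV[R]_n (cone_over v C).
Proof.
rewrite !convex_setP => cvC _ _ l [t + [y Cy <-]] [t' + [y' Cy' <-]] l0 l1.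
rewrite /= !in_itv /= => /andP[t0 t1] /andP[t'0 t'1].
pose p := l * (1 - t); pose q := (1 - l) * (1 - t').
have p0 : 0 <= p by rewrite mulr_ge0// subr_ge0.
have q0 : 0 <= q by rewrite mulr_ge0// subr_ge0.
have -> : l *: (t *: v + (1 - t) *: y) + (1 - l) *: (t' *: v + (1 - t') *: y') =
          (1 - (p + q)) *: v + (p *: y + q *: y').
  by apply/rowP => j; rewrite !mxE /p /q; ring.
have pq1 : p + q <= 1 by rewrite /p /q; nra.
exists (1 - (p + q)).
  by rewrite /= in_itv /= subr_ge0 pq1 gerBl addr_ge0.
rewrite subKr; have [pq0|pq0] := eqVneq (p + q) 0.
  move/eqP: pq0; rewrite paddr_eq0// => /andP[/eqP -> /eqP ->].
  by exists y; rewrite // !(addr0, scale0r).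
exists (p / (p + q) *: y + (1 - p / (p + q)) *: y').
  apply: cvC => //; first by rewrite divr_ge0// addr_ge0.
  by rewrite ler_pdivrMr ?mul1r ?lerDl// lt_neqAle eq_sym pq0 addr_ge0.
congr (_ + _); rewrite scalerDr !scalerA mulrBr mulr1 mulrCA mulfV// mulr1.
by rewrite [p + _]addrC addrK.
Qed.

Lemma cone_over_compact (R : realType) n (v : 'rV[R]_n) (C : set 'rV[R]_n) :
  compact C -> compact (cone_over v C).
Proof.
move=> cC; pose f (p : R * 'rV[R]_n) := p.1 *: v + (1 - p.1) *: p.2.
have -> : cone_over v C = f @` (`[0, 1] `*` C).
  apply/seteqP; split=> [_ [t t01 [y Cy <-]]|_ [[t y] [/= t01 Cy] <-]].
    by exists (t, y).
  by exists t => //; exists y.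
apply: continuous_compact; last by apply: compact_setX => //; exact: segment_compact.
apply: continuous_subspaceT => p; apply: cvgD.
  by apply: cvgZr_tmp; exact: cvg_fst.
apply: cvgZ; last exact: cvg_snd.
by apply: cvgB; [exact: cvg_cst|exact: cvg_fst].
Qed.

(** Adding a point to a nonempty finite set replaces its hull by the cone over
    that hull, which is the continuous image of a compact product. *)
Lemma convex_hull_seq_compact (R : realType) n (s : seq 'rV[R]_n) :
  compact (convex_hull [set` s]).
Proof.
case: s => [|v s].
  rewrite (_ : [set` _] = set0) ?convex_hull0; first exact: compact0.
  by apply/seteqP; split.
elim: s v => [|w s IHs] v.
  have -> : convex_hull [set` [:: v]] = [set v].
    apply/seteqP; split; last by move=> _ ->; apply: convex_hull_sub; rewrite /= mem_head.
    apply: convex_hull_min => [|x /=]; last by rewrite in_cons orbF => /eqP.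
    apply/convex_setP => _ _ t -> -> _ _ /=.
    by rewrite -scalerDl addrC subrK scale1r.
  exact: compact_set1.
have -> : convex_hull [set` v :: w :: s] = cone_over v (convex_hull [set` w :: s]).
  apply/seteqP; split.
    apply: convex_hull_min; first exact: cone_over_convex (@convex_hull_convex _ _ _).
    move=> x /=; rewrite in_cons => /predU1P[->|xs].
      exists 1; first by rewrite /= in_itv /= ler01 lexx.
      exists w; first by apply: convex_hull_sub; rewrite /= mem_head.
      by rewrite subrr scale0r addr0 scale1r.
    exists 0; first by rewrite /= in_itv /= ler01 lexx.
    exists x; first exact: convex_hull_sub.
    by rewrite scale0r add0r subr0 scale1r.
  move=> _ [t + [y Cy <-]]; rewrite /= in_itv /= => /andP[t0 t1].
  have /convex_setP cv := @convex_hull_convex R n [set` v :: w :: s].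
  apply: cv => //; first by apply: convex_hull_sub; rewrite /= mem_head.
  apply: (convex_hull_min (@convex_hull_convex R n [set` v :: w :: s])) Cy => x /= xs.
  by apply: convex_hull_sub; rewrite /= in_cons xs orbT.
exact: cone_over_compact (IHs w).
Qed.

(** * Linear forms and faces *)

Lemma dot_convex (R : realType) n (w x y : 'rV[R]_n) (s t : R) :
  dot w (s *: x + t *: y) = s * dot w x + t * dot w y.
Proof.
rewrite /dot !mulr_sumr -big_split; apply: eq_bigr => j _.
by rewrite !mxE /=; ring.
Qed.

Lemma dotDl (R : realType) n (w w' x : 'rV[R]_n) :
  dot (w + w') x = dot w x + dot w' x.
Proof. by rewrite /dot -big_split; apply: eq_bigr => j _; rewrite !mxE mulrDl. Qed.

Lemma dot_continuous (R : realType) n (w : 'rV[R]_n) : continuous (dot w).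
Proof.
apply: continuous_big => [|i _ x]; first exact: add_continuous.
apply: continuousM; first exact: cst_continuous.
exact: coord_continuous.
Qed.

Lemma closed_halfspace (R : realType) n (w : 'rV[R]_n) (c : R) :
  closed [set x | c <= dot w x].
Proof.
have /continuous_closedP dotC := @dot_continuous R n w.
by apply: (dotC [set y | c <= y]); exact: closed_ge.
Qed.

Lemma convex_ge_halfspace (R : realType) n (w : 'rV[R]_n) (c : R) :
  @convex_set R 'rV[R]_n [set x | c <= dot w x].
Proof.
apply/convex_setP => x y t /= cx cy t0 t1; rewrite dot_convex.
nra.
Qed.

(** If a proper convex combination attains the maximum c of a linear form, so do
    both of its ends; hence the points of the hull that lie in the hull of the
    maximal points as soon as they are maximal form a convex set. *)
Lemma convex_hull_eq_face (R : realType) n (X : set 'rV[R]_n) (w : 'rV[R]_n) (c : R) :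
  X `<=` [set x | dot w x <= c] ->
  convex_hull X `&` [set x | dot w x = c] = convex_hull (X `&` [set x | dot w x = c]).
Proof.
move=> Xc; set Y := X `&` _; have /convex_setP cvY := @convex_hull_convex R n Y.
apply/seteqP; split.
  suff sub : convex_hull X `<=`
      [set x | dot w x <= c /\ (dot w x = c -> convex_hull Y x)].
    by move=> x [/sub[_ +] xc]; apply.
  apply: convex_hull_min => [|x Xx]; last first.
    by split; [exact: Xc | move=> xc; apply: convex_hull_sub].
  apply/convex_setP => x y t [xc xY] [yc yY] t0 t1.
  rewrite /= dot_convex; split; first nra.
  have [->|tN0] := eqVneq t 0.
    by rewrite mul0r add0r subr0 mul1r scale0r add0r scale1r.
  have [->|tN1] := eqVneq t 1.
    by rewrite mul1r subrr mul0r addr0 scale0r addr0 scale1r.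
  have t_gt0 : 0 < t by rewrite lt_neqAle eq_sym tN0.
  have t_lt1 : t < 1 by rewrite lt_neqAle tN1.
  by move=> tc; apply: cvY => //; [apply: xY|apply: yY]; nra.
apply: convex_hull_min.
  apply/convex_setP => x y t [hx /= xc] [hy /= yc] t0 t1; split.
    by have /convex_setP cvX := @convex_hull_convex R n X; apply: cvX.
  by rewrite /= dot_convex xc yc; ring.
by move=> x [Xx xc]; split => //; apply: convex_hull_sub.
Qed.

Lemma face_refl (R : realType) n (P : set 'rV[R]_n) : face P P.
Proof.
exists 0, 0; have dot0 x : dot (0 : 'rV[R]_n) x = 0.
  by rewrite /dot big1 // => i _; rewrite mxE mul0r.
split=> [x _ /=|]; first by rewrite dot0.
by apply/seteqP; split=> [x Px|x []//]; split => //=.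
Qed.

Lemma face_set0 (R : realType) n (P : set 'rV[R]_n) : face set0 P.
Proof.
exists 0, 1; have dot0 x : dot (0 : 'rV[R]_n) x = 0.
  by rewrite /dot big1 // => i _; rewrite mxE mul0r.
split=> [x _ /=|]; first by rewrite dot0.
apply/esym; rewrite -subset0 => x [_ /= /eqP].
by rewrite dot0 eq_sym oner_eq0.
Qed.

(** The sum of two forms attains the sum of their bounds only where both
    bounds are attained. *)
Lemma faceI (R : realType) n (F G P : set 'rV[R]_n) :
  face F P -> face G P -> face (F `&` G) P.
Proof.
move=> [w [c [Pc ->]]] [w' [c' [Pc' ->]]]; exists (w + w'), (c + c'); split.
  by move=> x Px /=; rewrite dotDl lerD ?[_ <= c]Pc ?[_ <= c']Pc'.
apply/seteqP; split=> x /=; first by move=> [[Px xc] [_ xc']]; rewrite dotDl xc xc'.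
rewrite dotDl => -[Px eqc]; have xc := Pc _ Px; have xc' := Pc' _ Px.
rewrite /= in xc xc'; do 2 split => //; lra.
Qed.

(** * Matroid polytopes and their faces *)

Lemma indicator_vectorE (R : realType) n (B : {set 'I_n}) j :
  indicator_vector R B 0 j = (j \in B)%:R.
Proof.
rewrite /indicator_vector summxE; under eq_bigr do rewrite mxE eqxx /=.
have [jB|jB] := boolP (j \in B).
  rewrite (bigD1 j)//= eqxx big1 ?addr0// => b /andP[_ /negPf].
  by rewrite eq_sym => ->.
rewrite big1// => b bB; case: eqVneq => // jb.
by rewrite jb bB in jB.
Qed.

Lemma dot_indicator (R : realType) n (w : 'rV[R]_n) (B : {set 'I_n}) :
  dot w (indicator_vector R B) = \sum_(b in B) w 0 b.
Proof.
rewrite /dot [RHS]big_mkcond; apply: eq_bigr => j _.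
by rewrite indicator_vectorE; case: ifP; rewrite ?mulr1 ?mulr0.
Qed.

Lemma dotNl (R : realType) n (w x : 'rV[R]_n) : dot (- w) x = - dot w x.
Proof. by rewrite /dot -sumrN; apply: eq_bigr => j _; rewrite mxE mulNr. Qed.

Lemma matroid_polytope_compact (R : realType) n (M : matroid n) :
  compact (matroid_polytope R M).
Proof.
rewrite /matroid_polytope.
have -> : [set indicator_vector R B | B in [set` bases M]] =
          [set` [seq indicator_vector R B | B <- enum (bases M)]].
  apply/seteqP; split=> [_ [B BM <-]|x /= /mapP[B]].
    by apply: map_f; rewrite mem_enum.
  by rewrite mem_enum => BM ->; exists B.
exact: convex_hull_seq_compact.
Qed.

Lemma weight_exchange (R : realType) n (w : 'rV[R]_n) (B : {set 'I_n}) b c :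
  b \in B -> c \notin B ->
  \sum_(j in c |: (B :\ b)) w 0 j = \sum_(j in B) w 0 j - w 0 b + w 0 c.
Proof.
move=> bB cB; rewrite big_setU1 /=; last by rewrite !finset.inE (negPf cB) andbF.
by rewrite (big_setD1 b bB) /=; ring.
Qed.

(** A symmetric exchange between two bases of maximal weight preserves the sum
    of the weights, so both of the resulting bases are again maximal. *)
Lemma basis_exchange_max (R : realType) n (BB : {set {set 'I_n}}) (w : 'rV[R]_n) (c : R) :
  basis_exchange BB -> (forall B, B \in BB -> \sum_(b in B) w 0 b <= c) ->
  basis_exchange (finset (fun B => (B \in BB) && (\sum_(b in B) w 0 b == c))).
Proof.
move=> ex le_c; apply/basis_exchangeP => B1 B2 b1.
rewrite !finset.inE => /andP[B1in /eqP w1] /andP[B2in /eqP w2] b1B1 b1B2.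
have [b2 [b2B2 b2B1 new1 new2]] := symmetric_exchange ex B1in B2in b1B1 b1B2.
exists b2; split=> //; rewrite !finset.inE new1 /=.
have := le_c _ new2; have := le_c _ new1.
rewrite !weight_exchange// w1 w2 => le1 le2.
apply/eqP; lra.
Qed.

(** The matroid of the face consists of the bases on which the linear form
    defining the face is maximal. *)
Lemma face_matroid (R : realType) n (M : matroid n) (F : set 'rV[R]_n) :
  face F (matroid_polytope R M) -> exists N : matroid n, matroid_polytope R N = F.
Proof.
case=> w [c [le_c ->]].
have wle B : B \in bases M -> \sum_(b in B) w 0 b <= c.
  move=> BM; rewrite -dot_indicator; apply: le_c; apply: convex_hull_sub.
  by exists B.
exists (Matroid (basis_exchange_max (valP M) wle)).
rewrite /matroid_polytope convex_hull_eq_face; last first.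
  by move=> _ [B BM <-] /=; rewrite dot_indicator wle.
congr convex_hull; apply/seteqP; split=> x.
  case=> B /=; rewrite finset.inE => /andP[BM /eqP wB] <-.
  by split; [exists B | rewrite /= dot_indicator].
case=> -[B BM <-] /=; rewrite dot_indicator => wB.
by exists B; rewrite //= finset.inE BM wB eqxx.
Qed.

(** For nonempty A the intersection of the cells is a face of each of them, so
    the matroid chosen by [cell_matroid] does have this polytope.  Intersecting
    with the polytope of M also covers the case of empty A. *)
Lemma cell_polytope (R : realType) n (M : matroid n) m (Ms : 'I_m -> matroid n)
    (A : {set 'I_m}) :
  matroid_subdivision R M Ms ->
  matroid_polytope R (cell_matroid R M Ms A) =
  matroid_polytope R M `&` [set x | forall a, a \in A -> matroid_polytope R (Ms a) x].
Proof.
case=> _ _ cover cells; rewrite /cell_matroid; case: ifPn => [/eqP ->|].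
  by apply/seteqP; split=> [x Mx|x []//]; split => // a; rewrite finset.inE.
case/finset.set0Pn => a0 a0A.
have -> : matroid_polytope R M `&`
    [set x | forall a, a \in A -> matroid_polytope R (Ms a) x] =
    \bigcap_(a in [set` A]) matroid_polytope R (Ms a).
  apply/seteqP; split=> [x [_ +] a /=|x Ax]; first exact.
  by split=> [|a /Ax//]; rewrite -cover; exists a0 => //; exact: Ax.
apply: (@xgetPex _ _ [set N | matroid_polytope R N = _]).
have face_cell a : face (matroid_polytope R (Ms a0) `&` matroid_polytope R (Ms a))
    (matroid_polytope R (Ms a0)).
  have [->|aa0] := eqVneq a a0; first by rewrite setIid; exact: face_refl.
  have [->|/set0P I0] :=
      eqVneq (matroid_polytope R (Ms a0) `&` matroid_polytope R (Ms a)) set0.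
    exact: face_set0.
  have [lt|gt|/val_inj eq_a] := ltngtP a a0; last by rewrite eq_a eqxx in aa0.
    by rewrite setIC in I0 *; have [_ []] := cells _ _ lt I0.
  by have [[]] := cells _ _ gt I0.
apply: (@face_matroid _ _ (Ms a0)).
have -> : \bigcap_(a in [set` A]) matroid_polytope R (Ms a) =
    matroid_polytope R (Ms a0) `&`
    [set x | forall a, a \in enum A -> matroid_polytope R (Ms a) x].
  apply/seteqP; split=> [x Ax|x [_ Ax] a /= aA]; last by apply: Ax; rewrite mem_enum.
  by split=> [|a]; [exact: Ax | rewrite mem_enum => aA; exact: Ax].
elim: (enum A) => [|a s IHs].
  rewrite (_ : _ `&` _ = matroid_polytope R (Ms a0)); first exact: face_refl.
  by apply/seteqP; split=> [x []|x].
have := faceI (face_cell a) IHs; congr face; apply/seteqP; split=> x /=.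
  move=> [[x0 xa] [_ xs]]; split=> // b; rewrite in_cons => /predU1P[-> //|]; exact: xs.
move=> [x0 xs]; split; split=> //; first by apply: xs; rewrite mem_head.
by move=> b bs; apply: xs; rewrite in_cons bs orbT.
Qed.

(** * Rank as the maximum of a linear form *)

(** The trace on A of a basis extends to a maximal independent subset of A, and
    each such subset is contained in the trace of a basis. *)
Lemma rankE n (M : matroid n) (A : {set 'I_n}) :
  rank M A = (\max_(B in bases M) #|B :&: A|)%N.
Proof.
apply/eqP; rewrite eqn_leq; apply/andP.
split; apply/bigmax_leqP; [move=> I maxI | move=> B Bin].
  have := maxsetp maxI => /= /andP[/exists_inP[B Bin IB] IA].
  have IBA : (#|I| <= #|B :&: A|)%N by rewrite subset_leq_card// finset.subsetI IB IA.
  apply: leq_trans IBA _.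
  exact: (@leq_bigmax_cond _ (mem (bases M)) (fun B : {set 'I_n} => #|B :&: A|) B Bin).
have pI : [pred J : {set 'I_n} | independent M J & J \subset A] (B :&: A).
  rewrite /= finset.subsetIr andbT; apply/exists_inP.
  by exists B; rewrite ?finset.subsetIl.
have [J maxJ subJ] := maxset_exists pI.
apply: leq_trans (subset_leq_card subJ) _.
exact: (@leq_bigmax_cond _ _ (fun J : {set 'I_n} => #|J|) J maxJ).
Qed.

(** At the vertex e_B the form e_A takes the value #|B :&: A|, and its maximum
    over the hull is attained at a vertex. *)
Lemma polytope_halfspace_rank (R : realType) n (M : matroid n) (A : {set 'I_n})
    (s : nat) :
  (matroid_polytope R M `&` [set x | s%:R <= dot (indicator_vector R A) x] !=set0) <->
  (bases M != finset.set0) && (s <= rank M A)%N.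
Proof.
have dotE B : dot (indicator_vector R A) (indicator_vector R B) = #|B :&: A|%:R.
  rewrite dot_indicator -sum1_card natr_sum [LHS]big_mkcond [RHS]big_mkcond.
  apply: eq_bigr => j _; rewrite indicator_vectorE finset.inE.
  by case: (j \in B); case: (j \in A).
split=> [[x [Mx /= sx]]|/andP[/finset.set0Pn[B0 B0M] sr]].
  have bases0 : bases M != finset.set0.
    apply/eqP => M0; suff vert0 : [set indicator_vector R B | B in [set` bases M]] = set0.
      by move: Mx; rewrite /matroid_polytope vert0 convex_hull0.
    by rewrite -subset0 => v [B /=]; rewrite M0 finset.inE.
  rewrite bases0 -(@ler_nat R); apply: le_trans sx _.
  (* The halfspace {e_A <= r_M(A)}, written with the opposite form. *)
  have le_rank : matroid_polytope R M `<=`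
      [set x | - (rank M A)%:R <= dot (- indicator_vector R A) x].
    apply: convex_hull_min; first exact: convex_ge_halfspace.
    move=> _ [B BM <-] /=; rewrite dotNl lerN2 dotE ler_nat rankE.
    exact: (@leq_bigmax_cond _ (mem (bases M)) (fun B : {set 'I_n} => #|B :&: A|) B BM).
  by have := le_rank _ Mx; rewrite /= dotNl lerN2.
have [B BM Bmax] := @eq_bigmax_cond _ (mem (bases M)) (fun B : {set 'I_n} => #|B :&: A|)
  (introT card_gt0P (ex_intro _ B0 B0M)).
exists (indicator_vector R B); split; first by apply: convex_hull_sub; exists B.
by rewrite /= dotE ler_nat -Bmax -rankE.
Qed.

(** The indicator of r_M(A) = s is the difference of those of r_M(A) >= s and
    r_M(A) >= s + 1; the halfspace conditions also give 0 for the matroid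
    without bases, whose polytope is empty. *)
Lemma coeff_rank_sum (R : realType) n (M : matroid n) (A : {set 'I_n}) (s : nat) :
  let meets k := `[< matroid_polytope R M `&`
                     [set x | k%:R <= dot (indicator_vector R A) x] !=set0 >] in
  coeff (A, s) (rank_sum M) = (meets s)%:R - (meets s.+1)%:R.
Proof.
have meetsE k : `[< matroid_polytope R M `&`
    [set x | k%:R <= dot (indicator_vector R A) x] !=set0 >] =
    (bases M != finset.set0) && (k <= rank M A)%N.
  apply/asboolP/idP; first by move/polytope_halfspace_rank.
  by move=> ?; apply/polytope_halfspace_rank.
rewrite /= !meetsE /rank_sum; case: eqVneq => _ /=; first by rewrite coeff0 subrr.
rewrite raddf_sum (bigD1 A) //= big1 ?addr0 => [|B BA].
  rewrite coeffU mul1r xpair_eqE eqxx /=.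
  by case: (ltngtP s (rank M A)).
by rewrite coeffU mul1r xpair_eqE (negPf BA).
Qed.

(** * The valuation property *)

(** This is the expansion of the product over i of 1 - [T i], in which the
    factor at i0 vanishes. *)
Lemma alternating_subset_sum (I : finType) (T : pred I) i0 : T i0 ->
  \sum_(A : {set I}) (-1) ^+ #|A| * [forall i in A, T i]%:R = 0 :> int.
Proof.
move=> Ti0.
have -> : \sum_(A : {set I}) (-1) ^+ #|A| * [forall i in A, T i]%:R =
    \prod_i (- (T i)%:R + 1) :> int.
  rewrite bigA_distr; apply: eq_big => // A _.
  rewrite -big_mkcond /= prodrN; congr (_ * _).
  have [/forall_inP TA|] := boolP [forall i in A, T i].
    by rewrite big1// => i /TA ->.
  rewrite negb_forall => /existsP[i]; rewrite negb_imply => /andP[iA /negPf Ti].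
  by rewrite (bigD1 i)//= Ti mul0r.
by rewrite (bigD1 i0)//= Ti0 addNr mul0r.
Qed.

Theorem theorem5p1 (R : realType) (n : nat) (hn : (0 < n)%N) :
  is_valuation R (@rank_sum n).
Proof.
split=> [|M m Ms sub]; first by rewrite /rank_sum eqxx.
have cover : \bigcup_i matroid_polytope R (Ms i) = matroid_polytope R M by case: sub.
have meets0 (A : {set 'I_n}) (s : nat) :
    \sum_(J : {set 'I_m}) (-1) ^+ #|J| *
      `[< matroid_polytope R (cell_matroid R M Ms J) `&`
          [set x | s%:R <= dot (indicator_vector R A) x] !=set0 >]%:R = 0 :> int.
  apply: (@compact_convex_euler R n {set 'I_m} _ (fun J =>
     matroid_polytope R (cell_matroid R M Ms J) `&`
          [set x | s%:R <= dot (indicator_vector R A) x])) => [J|J|x].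
  - by apply: convexI; [exact: convex_hull_convex | exact: convex_ge_halfspace].
  - by apply: compact_closedI; [exact: matroid_polytope_compact | exact: closed_halfspace].
  (* Pointwise, this is inclusion-exclusion over the cells containing x. *)
  have [Hx|Hx] :=
    boolP `[< matroid_polytope R M x /\ s%:R <= dot (indicator_vector R A) x >];
    last first.
    apply: big1 => J _; rewrite asboolF ?mulr0// => -[].
    rewrite cell_polytope// => -[Mx _] sx.
    by move/asboolPn: Hx; apply.
  move/asboolP: Hx => [Mx sx].
  have [i0 _ i0x] : (\bigcup_i matroid_polytope R (Ms i)) x by rewrite cover.
  pose T i := `[< matroid_polytope R (Ms i) x >].
  have Ti0 : T i0 by apply/asboolP.
  rewrite -[RHS](alternating_subset_sum Ti0); apply: eq_bigr => J _.
  congr (_ * (nat_of_bool _)%:R); rewrite cell_polytope//.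
  apply/asboolP/forall_inP => [[[_ Jx] _] i /Jx ?|JT]; first exact/asboolP.
  by split=> //; split=> // i /JT /asboolP.
apply/eqP/freeg_eqP => -[A s]; rewrite coeff0 raddf_sum /=.
under eq_bigr do rewrite raddfMz /= (coeff_rank_sum R) mulrzz mulrC mulrBr.
by rewrite sumrB !meets0 subrr.
Qed.
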